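(* Let $A\subset\mathbb{R}$ be a finite set. Then there exists a subset $A'\subseteq A$ with $|A'|\geq |A|/2$ such that for all $a\in A'$, $$|(A+A)(A+a)|\gg \frac{|A|^{5/3}}{(\log|A|)^{1/3}},$$ where $(A+A)(A+a)=\{(b+c)(d+a): b,c,d\in A\}$.
   Context: $X\gg Y$ means $X\geq cY$ for some absolute constant $c>0$ (independent of $A$ and $a$). Logarithms are to base 2. *)

(* Defs.v *)
From HB Require Import structures.
From mathcomp Require Import all_boot all_order all_algebra.
From mathcomp Require Import all_classical all_reals all_analysis.
From mathcomp Require Import finmap.
Set Implicit Arguments. Unset Strict Implicit. Unset Printing Implicit Defensive.
Import Order.TTheory GRing.Theory Num.Theory.
Local Open Scope ring_scope.
Local Open Scope fset_scope.

Definition sumset (R : realType) (X Y : {fset R}) : {fset R} :=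
  [fset (x + y)%R | x in X, y in Y].
Definition prodset (R : realType) (X Y : {fset R}) : {fset R} :=
  [fset (x * y)%R | x in X, y in Y].
Definition translate (R : realType) (A : {fset R}) (a : R) : {fset R} :=
  [fset (d + a)%R | d in A].
Definition AA_Aa (R : realType) (A : {fset R}) (a : R) : {fset R} :=
  prodset (sumset A A) (translate A a).
Definition log2 (R : realType) (x : R) : R := ln x / ln 2.

(* Main.v *)
Require Import Defs.
From HB Require Import structures.
From mathcomp Require Import all_boot all_order all_algebra.
From mathcomp Require Import all_classical all_reals all_analysis.
From mathcomp Require Import finmap.
From mathcomp Require Import zify ring lra.
Import Order.TTheory GRing.Theory Num.Theory.
Local Open Scope ring_scope.

(** Let [n] be the size of [A], [N l] the number of points of [A * A] on a line
    [l], and [B] the set of nonzero elements of [A + a].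

    The grid version of the Szemeredi-Trotter theorem gives that the sum of
    [N l ^ 3] over any [O(n ^ 4)] nonaxial lines is [O(n ^ 4 log n)]: cut the
    grid into [s * s] cells; a monotone line meets fewer than [2 s] of them, so
    by Cauchy-Schwarz it has many pairs of points in a common cell, whereas
    every such pair lies on a single line.  Summing over [s] with weight [s]
    produces the cubes.

    The number [k r] of representations of [r] as a ratio of elements of [B] is
    at most [N l] for the line [l] of slope [r] through [(- a, - a)], so for at
    least half of the [a] the sum of [k r ^ 3] is [O(n ^ 3 log n)].

    By Cauchy-Schwarz, [n ^ 6] is at most a constant times the size of
    [(A + A) * B] times the number of solutions of [b (x + y) = b' (x' + y')],
    and the latter is at most the sum of [k r * N l ^ 2] over the lines [l] of
    slope [r].  The two cubic moments bound this sum by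
    [O(n ^ (17/4) log n) = O(n ^ (13/3))]. *)

(** * Double counting and Cauchy-Schwarz *)

Lemma sum_bool_count (I : Type) (s : seq I) (P : pred I) :
  (\sum_(x <- s) (P x : nat) = count P s)%N.
Proof. by rewrite -sum1_count [RHS]big_mkcond /=; apply: eq_bigr => i _; case: (P i). Qed.

Lemma sum_eq_weight (J : eqType) (t : seq J) (y : J) (F : J -> nat) :
  uniq t -> y \in t -> (\sum_(z <- t) (y == z) * F z = F y)%N.
Proof.
move=> ut yt; rewrite (bigD1_seq y) //= eqxx mul1n big1 ?addn0 // => z zy.
by rewrite eq_sym (negbTE zy).
Qed.

(** Pairs are grouped by their common value [q], so that each [q] contributes a product of two fiber
    sizes. *)
Lemma sum_coincidences (I1 I2 J : eqType) (s1 : seq I1) (s2 : seq I2) (t : seq J)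
    (g : I1 -> J) (h : I2 -> J) :
  uniq t -> {in s1, forall u, g u \in t} ->
  (\sum_(u <- s1) \sum_(v <- s2) (g u == h v) =
   \sum_(q <- t) count (fun u => g u == q) s1 * count (fun v => h v == q) s2)%N.
Proof.
move=> ut gt.
under [RHS]eq_bigr => q _ do rewrite -sum_bool_count big_distrl /=.
rewrite [RHS]exchange_big /= [LHS]big_seq [RHS]big_seq; apply: eq_bigr => u us.
rewrite (sum_eq_weight _ _ _ (fun q => count (fun v => h v == q) s2) ut (gt u us)).
by rewrite -sum_bool_count; apply: eq_bigr => v _; rewrite eq_sym.
Qed.

Lemma sum_fibers (I J : eqType) (s : seq I) (t : seq J) (f : I -> J) (F : J -> nat) :
  uniq t -> {in s, forall x, f x \in t} ->
  (\sum_(x <- s) F (f x) = \sum_(y <- t) count (fun x => f x == y) s * F y)%N.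
Proof.
move=> ut ft.
under [RHS]eq_bigr => y _ do rewrite -sum_bool_count big_distrl /=.
rewrite [RHS]exchange_big /= [LHS]big_seq [RHS]big_seq; apply: eq_bigr => x xs.
by rewrite (sum_eq_weight _ _ _ F ut (ft x xs)).
Qed.

Lemma sqr_sum_le (I : Type) (s : seq I) (F : I -> nat) :
  ((\sum_(x <- s) F x) ^ 2 <= size s * \sum_(x <- s) F x ^ 2)%N.
Proof.
rewrite -(leq_pmul2l (isT : (0 < 2)%N)) -mulnn big_distrlr /= big_distrr /=.
apply: (@leq_trans (\sum_(x <- s) \sum_(y <- s) (F x ^ 2 + F y ^ 2))%N).
  apply: leq_sum => x _; rewrite big_distrr /=; apply: leq_sum => y _.
  exact: nat_Cauchy.
rewrite eq_leq // [LHS](eq_bigr (fun x => (size s * F x ^ 2 + \sum_(y <- s) F y ^ 2)%N)).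
  by rewrite big_split /= -big_distrr /= big_const_seq count_predT iter_addn_0 mul2n -addnn mulnC.
by move=> x _; rewrite big_split /= big_const_seq count_predT iter_addn_0 mulnC.
Qed.

(** Cauchy-Schwarz on the fiber sizes of [f]: they add up to [size s], and their squares add up to
    the number of coincidences. *)
Lemma sqr_size_le_coincidences (I J : eqType) (s : seq I) (t : seq J) (f : I -> J) :
  uniq t -> {in s, forall x, f x \in t} ->
  (size s ^ 2 <= size t * \sum_(u <- s) \sum_(v <- s) (f u == f v))%N.
Proof.
move=> ut ft; rewrite (sum_coincidences _ _ _ _ _ _ _ _ ut ft).
have -> : size s = (\sum_(y <- t) count (fun x => f x == y) s)%N.
  rewrite -sum1_size (sum_fibers _ _ _ _ f (fun=> 1%N) ut ft).
  by apply: eq_bigr => y _; rewrite muln1.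
exact: leq_trans (sqr_sum_le _ _ _) _.
Qed.

(** With [c q] the size of the fiber of [g] over [q], the left side sums [c q * c (- q)], and [2 * c
    q * c (- q) <= c q ^ 2 + c (- q) ^ 2]; both squares have the same total. *)
Lemma coincidences_opp_le (I : eqType) (V : zmodType) (s : seq I) (g : I -> V) :
  (\sum_(u <- s) \sum_(v <- s) (g u == - g v)
   <= \sum_(u <- s) \sum_(v <- s) (g u == g v))%N.
Proof.
pose t := undup (map g s ++ map (fun u => - g u) s).
have ut : uniq t by exact: undup_uniq.
have gt : {in s, forall u, g u \in t}.
  by move=> u us; rewrite mem_undup mem_cat map_f.
have ht : {in s, forall u, - g u \in t}.
  by move=> u us; rewrite mem_undup mem_cat (map_f (fun u => - g u)) ?orbT.
rewrite -(leq_pmul2l (isT : (0 < 2)%N)).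
have e2 : (2 * \sum_(u <- s) \sum_(v <- s) (g u == g v) =
   \sum_(u <- s) \sum_(v <- s) (g u == g v)
   + \sum_(u <- s) \sum_(v <- s) ((- g u)%R == - g v))%N.
  rewrite mul2n -addnn; congr addn; apply: eq_bigr => u _.
  by apply: eq_bigr => v _; rewrite eqr_opp.
rewrite e2 !(sum_coincidences _ _ _ _ _ _ _ _ ut gt) (sum_coincidences _ _ _ _ _ _ _ _ ut ht).
rewrite big_distrr /= -big_split /=; apply: leq_sum => q _; rewrite !mulnn.
exact: nat_Cauchy.
Qed.

(** * Incidences between lines and a grid *)

Definition rank_in (R : realDomainType) (A : seq R) (x : R) : nat :=
  count (fun y => y < x) A.

(** Ranks are cut into runs of [size A %/ s + 1]; the successor keeps the width positive and the
    index below [s] when [s > 0]. *)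
Definition block (R : realDomainType) (A : seq R) (s : nat) (x : R) : nat :=
  (rank_in R A x %/ (size A %/ s).+1)%N.

(** This is [N l] for the line [y = m * x + q], whose points are recorded by their first
    coordinates. *)
Definition richness (R : realDomainType) (A : seq R) (m q : R) : nat :=
  count (fun x => m * x + q \in A) A.

Lemma rank_in_le (R : realDomainType) (A : seq R) (x y : R) :
  x <= y -> (rank_in R A x <= rank_in R A y)%N.
Proof. by move=> xy; apply: sub_count => z /= zx; apply: lt_le_trans zx xy. Qed.

Lemma rank_in_lt (R : realDomainType) (A : seq R) (x y : R) :
  x \in A -> x < y -> (rank_in R A x < rank_in R A y)%N.
Proof.
elim: A => //= z A IH; rewrite inE => /orP[/eqP <- |xA] xy.
  by rewrite ltxx xy add0n ltnS; apply: rank_in_le (ltW xy).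
have := IH xA xy; case: (ltP z x) => [zx|_] /=; last by rewrite /rank_in; lia.
by rewrite (lt_trans zx xy) !add1n.
Qed.

Lemma rank_in_bound (R : realDomainType) (A : seq R) (x : R) :
  x \in A -> (rank_in R A x < size A)%N.
Proof.
move=> xA; rewrite -(count_predC (fun y => y < x) A) -/(rank_in _ _ _).
rewrite -[ltnLHS]addn0 ltn_add2l -has_count; apply/hasP; exists x => //=.
by rewrite ltxx.
Qed.

Lemma rank_in_inj (R : realDomainType) (A : seq R) :
  {in A &, injective (rank_in R A)}.
Proof.
move=> x y xA yA; case: (ltgtP x y) => // xy e.
  by have := rank_in_lt _ _ _ _ xA xy; rewrite e ltnn.
by have := rank_in_lt _ _ _ _ yA xy; rewrite e ltnn.
Qed.

Lemma block_le (R : realDomainType) (A : seq R) (s : nat) (x y : R) :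
  x <= y -> (block R A s x <= block R A s y)%N.
Proof. by move=> xy; apply: leq_div2r; apply: rank_in_le. Qed.

Lemma block_lt (R : realDomainType) (A : seq R) (s : nat) (x : R) :
  (0 < s)%N -> x \in A -> (block R A s x < s)%N.
Proof.
move=> s0 xA; rewrite /block ltn_divLR // mulnC.
exact: leq_trans (rank_in_bound _ _ _ xA) (ltnW (ltn_ceil _ s0)).
Qed.

Lemma block_size (R : realDomainType) (A : seq R) (s j : nat) :
  uniq A -> (count (fun x => block R A s x == j) A <= (size A %/ s).+1)%N.
Proof.
move=> uA; set w := (size A %/ s).+1.
rewrite -size_filter -(size_map (rank_in R A)) -(size_iota (j * w) w).
apply: uniq_leq_size.
  rewrite map_inj_in_uniq ?filter_uniq // => x y.
  by rewrite !mem_filter => /andP[_ xA] /andP[_ yA]; apply: rank_in_inj.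
move=> r /mapP[x]; rewrite mem_filter => /andP[/eqP bx _] ->.
rewrite mem_iota -bx /block -/w leq_divM /=.
by rewrite [ltnLHS](divn_eq _ w) ltn_add2l ltn_pmod.
Qed.

Lemma same_block_pairs (R : realDomainType) (A : seq R) (s : nat) :
  uniq A ->
  (\sum_(x <- A) \sum_(y <- A) (block R A s x == block R A s y)
   <= size A * (size A %/ s).+1)%N.
Proof.
move=> uA; rewrite -[X in (X * _)%N]sum1_size big_distrl /=.
apply: leq_sum => x _; rewrite mul1n sum_bool_count.
apply: leq_trans (block_size _ A s (block R A s x) uA).
by apply: sub_count => y /=; rewrite eq_sym.
Qed.

(* A monotone chain of cells is determined by one integer coordinate
   (the sum of the block indices if the line increases, their difference
   if it decreases): a line meets fewer than [2 * s] of the [s * s] cells. *)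
Definition cell_key (R : realDomainType) (A : seq R) (s : nat) (m q x : R) : nat :=
  if 0 < m then (block R A s x + block R A s (m * x + q))%N
  else (block R A s x + (s - block R A s (m * x + q)))%N.

(** Along the line both summands of the key are weakly increasing in [x], so equal keys force equal
    summands. The subtraction is not truncated, since block indices are below [s]. *)
Lemma cell_key_inj (R : realDomainType) (A : seq R) (s : nat) (m q x y : R) :
  (0 < s)%N -> m != 0 -> m * x + q \in A -> m * y + q \in A ->
  cell_key R A s m q x = cell_key R A s m q y ->
  block R A s x = block R A s y /\
  block R A s (m * x + q) = block R A s (m * y + q).
Proof.
move=> s0 m0; wlog xy : x y / x <= y => [H|].
  by case: (leP x y) => [xy|/ltW yx] fx fy e; [|case: (H y x)]; auto.
move=> fx fy; have := block_lt _ _ _ _ s0 fx; have := block_lt _ _ _ _ s0 fy.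
have := block_le _ A s _ _ xy; rewrite /cell_key; case: (ltP 0 m) => m_sgn.
  have : (m * x + q <= m * y + q) by rewrite lerD2r ler_wpM2l // ltW.
  by move=> /(block_le _ A s); lia.
have : (m * y + q <= m * x + q) by rewrite lerD2r ler_wnM2l.
by move=> /(block_le _ A s); lia.
Qed.

Lemma cell_key_lt (R : realDomainType) (A : seq R) (s : nat) (m q x : R) :
  (0 < s)%N -> x \in A -> m * x + q \in A -> (cell_key R A s m q x < 2 * s)%N.
Proof.
move=> s0 xA fA; have := block_lt _ _ _ _ s0 fA; have := block_lt _ _ _ _ s0 xA.
by rewrite /cell_key; case: ifP => _; lia.
Qed.

Definition in_same_cell (R : realDomainType) (A : seq R) (s : nat) (m q x y : R) : bool :=
  [&& x != y, m * x + q \in A, m * y + q \in A,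
      block R A s x == block R A s y &
      block R A s (m * x + q) == block R A s (m * y + q)].

Definition cell_pairs (R : realDomainType) (A : seq R) (s : nat) (m q : R) : nat :=
  \sum_(x <- A) \sum_(y <- A) in_same_cell R A s m q x y.

(** Cauchy-Schwarz over the [2 * s] possible keys: points with equal keys share a cell, and the
    diagonal pairs account for the extra [richness]. *)
Lemma richness_sqr_le (R : realDomainType) (A : seq R) (s : nat) (m q : R) :
  uniq A -> (0 < s)%N -> m != 0 ->
  (richness R A m q ^ 2 <= 2 * s * (cell_pairs R A s m q + richness R A m q))%N.
Proof.
move=> uA s0 m0; pose P := [seq x <- A | m * x + q \in A].
have sP : size P = richness R A m q by rewrite size_filter.
have key_iota : {in P, forall x, cell_key R A s m q x \in iota 0 (2 * s)}.
  move=> x; rewrite mem_filter mem_iota leq0n add0n => /andP[fx xA].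
  exact: cell_key_lt.
have := sqr_size_le_coincidences _ _ _ _ _ (iota_uniq 0 (2 * s)) key_iota.
rewrite sP size_iota => /leq_trans; apply; rewrite leq_mul2l; apply/orP; right.
have -> : (cell_pairs R A s m q + richness R A m q =
  \sum_(x <- A) \sum_(y <- A)
    (in_same_cell R A s m q x y + (x == y) * (m * y + q \in A)%R))%N.
  rewrite /richness -sum_bool_count -[LHS]/(\sum_(x <- A) _ + _)%N.
  rewrite [in LHS]big_seq [X in (_ + X)%N]big_seq [RHS]big_seq -big_split /=.
  apply: eq_bigr => x xA; rewrite big_split /=; congr addn.
  by rewrite (sum_eq_weight _ _ _ (fun y => (m * y + q \in A : nat))).
rewrite big_filter big_mkcond /=; apply: leq_sum => x _; case: ifP => // fx.
rewrite big_filter big_mkcond /=; apply: leq_sum => y _; case: ifP => // fy.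
case: eqP => // /(cell_key_inj _ _ _ _ _ _ _ s0 m0 fx fy)[bx by_].
by rewrite /in_same_cell bx by_ fx fy !eqxx; case: (x == y).
Qed.

(** The quadratic bound is summed over [s <= S], where [S] is about [N / 4]; the [27] covers
    [N <= 3]. *)
Lemma richness_cube_le (R : realDomainType) (A : seq R) (m q : R) :
  uniq A -> m != 0 ->
  (richness R A m q ^ 3
   <= 32 * (\sum_(1 <= s < (size A).+1) s * cell_pairs R A s m q) + 27)%N.
Proof.
move=> uA m0; set N := richness R A m q.
have [N4|N4] := ltnP N 4.
  by apply: leq_trans (leq_addl _ _); rewrite -[27%N]/(3 ^ 3)%N leq_exp2r.
pose S := (N %/ 4)%N.
have SA : (S <= size A)%N by rewrite (leq_trans (leq_div _ _)) // count_size.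
have Ssum : (S * N ^ 2 <= 2 * (\sum_(1 <= s < S.+1) s * cell_pairs R A s m q)
              + S * S.+1 * N)%N.
  elim: S {SA} => [|S IH]; first by rewrite big_geq.
  rewrite big_nat_recr //= mulSn.
  have := richness_sqr_le _ A S.+1 m q uA isT m0; rewrite -/N; nia.
have : (\sum_(1 <= s < S.+1) s * cell_pairs R A s m q <=
        \sum_(1 <= s < (size A).+1) s * cell_pairs R A s m q)%N.
  by rewrite [leqRHS](big_cat_nat (n := S.+1)) //= leq_addr.
(* As [N >= 4], it follows that [S + 1 <= N / 2], so the error term absorbs at most half of
   [S * N ^ 2], and that [N <= 8 * S]. Hence the constant [32 = 8 * 4]. *)
have NS : (4 * S <= N < 4 * S + 4)%N.
  by rewrite [N](divn_eq N 4) -/S; have := ltn_pmod N (isT : (0 < 4)%N); lia.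
set X := (\sum_(1 <= s < S.+1) _)%N in Ssum *.
set Y := (\sum_(1 <= s < (size A).+1) _)%N; nia.
Qed.

Lemma count_le1 (I : eqType) (s : seq I) (P : pred I) :
  uniq s -> (forall x y, P x -> P y -> x = y) -> (count P s <= 1)%N.
Proof.
move=> us PI; have [/hasP[x xs Px]|] := boolP (has P s); last first.
  by rewrite has_count -leqNgt => /leq_trans; apply.
rewrite -size_filter -[1%N]/(size [:: x]); apply: uniq_leq_size.
  exact: filter_uniq.
by move=> y; rewrite mem_filter inE => /andP[Py _]; apply/eqP/PI.
Qed.

(** Two points with distinct first coordinates lie on at most one line ([D1]), so the sum is at most
    the number of pairs of grid points in a common cell. *)
Lemma sum_cell_pairs_le (R : realFieldType) (A : seq R) (s : nat) (L : seq (R * R)) :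
  uniq A -> uniq L ->
  (\sum_(l <- L) cell_pairs R A s l.1 l.2 <= (size A * (size A %/ s).+1) ^ 2)%N.
Proof.
move=> uA uL.
pose B (x y : R) : nat := (block R A s x == block R A s y).
pose D (x y u v : R) (l : R * R) :=
  [&& x != y, l.1 * x + l.2 == u & l.1 * y + l.2 == v].
have D1 x y u v : (\sum_(l <- L) D x y u v l <= 1)%N.
  rewrite sum_bool_count; apply: count_le1 => // -[m q] [m' q'].
  rewrite /D /= => /and3P[xy /eqP xu /eqP yv] /and3P[_ /eqP xu' /eqP yv'].
  have mm : m = m'.
    have : (m - m') * (x - y) = 0 by lra.
    by move=> /eqP; rewrite mulf_eq0 !subr_eq0 (negbTE xy) orbF => /eqP.
  by subst m'; congr pair; lra.
apply: (@leq_trans (\sum_(l <- L) \sum_(x <- A) \sum_(y <- A)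
    \sum_(u <- A) \sum_(v <- A) B x y * B u v * D x y u v l)%N).
  apply: leq_sum => -[m q] _; apply: leq_sum => x _; apply: leq_sum => y _ /=.
  rewrite /in_same_cell; case: and5P => // -[xy fx fy bx by_].
  rewrite (big_rem _ fx) /= (big_rem _ fy) /= /B bx by_ /D xy !eqxx.
  by rewrite -addnA leq_addr.
apply: (@leq_trans (\sum_(x <- A) \sum_(y <- A)
    \sum_(u <- A) \sum_(v <- A) B x y * B u v)%N).
  rewrite exchange_big; apply: leq_sum => x _ /=.
  rewrite exchange_big; apply: leq_sum => y _ /=.
  rewrite exchange_big; apply: leq_sum => u _ /=.
  rewrite exchange_big; apply: leq_sum => v _ /=.
  by rewrite -big_distrr /= -[leqRHS]muln1 leq_mul2l D1 orbT.
have -> : (\sum_(x <- A) \sum_(y <- A) \sum_(u <- A) \sum_(v <- A) B x y * B u v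
    = (\sum_(x <- A) \sum_(y <- A) B x y) ^ 2)%N.
  rewrite -mulnn big_distrl /=; apply: eq_bigr => x _.
  rewrite big_distrl /=; apply: eq_bigr => y _.
  rewrite big_distrr /=; apply: eq_bigr => u _.
  by rewrite big_distrr.
by rewrite leq_exp2r // same_block_pairs.
Qed.

(* The Szemeredi-Trotter theorem for the grid [A * A], in third-moment form. *)
Lemma sum_richness_cube_le (R : realFieldType) (A : seq R) (L : seq (R * R)) :
  uniq A -> uniq L -> {in L, forall l, l.1 != 0} ->
  ((\sum_(l <- L) richness R A l.1 l.2 ^ 3)%:R
   <= 128 * (size A)%:R ^+ 4 * (\sum_(1 <= s < (size A).+1) s%:R^-1)
      + 27 * (size L)%:R :> R).
Proof.
move=> uA uL L0; set n := size A.
have step1 : (\sum_(l <- L) richness R A l.1 l.2 ^ 3 <=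
  32 * (\sum_(1 <= s < n.+1) s * (n * (n %/ s).+1) ^ 2) + 27 * size L)%N.
  apply: (@leq_trans (\sum_(l <- L)
    (32 * (\sum_(1 <= s < n.+1) s * cell_pairs R A s l.1 l.2) + 27))%N).
    rewrite big_seq [leqRHS]big_seq; apply: leq_sum => l lL.
    by apply: richness_cube_le => //; apply: L0.
  rewrite big_split /= big_const_seq count_predT iter_addn_0 leq_add2r.
  rewrite -big_distrr /= leq_mul2l /= exchange_big /=; apply: leq_sum => s _.
  by rewrite -big_distrr /= leq_mul2l sum_cell_pairs_le ?orbT.
apply: le_trans (_ : _ <= (32 * (\sum_(1 <= s < n.+1) s * (n * (n %/ s).+1) ^ 2)
  + 27 * size L)%N%:R) _; first by rewrite ler_nat.
rewrite natrD !natrM lerD2r natr_sum -mulrA [leLHS]mulr_sumr !mulr_sumr.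
rewrite big_seq [leRHS]big_seq; apply: ler_sum => s; rewrite mem_index_iota => /andP[s0 sn].
(* Since [s * w <= n + s <= 2 * n] for the width [w], the term [s * (n * w) ^ 2] is at most
   [4 * n ^ 4 / s]; this produces the harmonic sum and [128 = 32 * 4]. *)
have sw : (s * (n %/ s).+1 <= 2 * n)%N.
  by have := leq_divM n s; rewrite mulnS mulnC; lia.
have sp : 0 < s%:R :> R by rewrite ltr0n.
have {}sw : s%:R * (n %/ s).+1%:R <= 2 * n%:R :> R by rewrite -!natrM ler_nat.
rewrite !mulrA ler_pdivlMr // natrM natrX natrM.
set w : R := (n %/ s).+1%:R in sw *; set nn : R := n%:R in sw *.
have w0 : 0 <= s%:R * w by rewrite mulr_ge0.
have n0 : 0 <= nn by [].
have -> : 32 * (s%:R * (nn * w) ^+ 2) * s%:R = 32 * nn ^+ 2 * (s%:R * w) ^+ 2.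
  by ring.
rewrite [leRHS](_ : _ = 32 * nn ^+ 2 * (2 * nn) ^+ 2); last by ring.
by rewrite ler_wpM2l ?mulr_ge0 ?exprn_ge0 // lerXn2r // nnegrE ?mulr_ge0.
Qed.

(** * Energies of ratios and dilates *)

Definition square (T : Type) (s : seq T) : seq (T * T) := [seq (x, y) | x <- s, y <- s].

Definition ratios (F : fieldType) (B : seq F) : seq F :=
  undup [seq p.2 / p.1 | p <- square F B].

Definition ratio_count (F : fieldType) (B : seq F) (r : F) : nat :=
  count (fun p => p.2 / p.1 == r) (square F B).

(** These index the lines of slope [r] that meet the grid. *)
Definition intercepts (F : fieldType) (A : seq F) (r : F) : seq F :=
  undup [seq p.2 - r * p.1 | p <- square F A].

Lemma size_square (T : Type) (s : seq T) : size (square T s) = (size s ^ 2)%N.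
Proof. by rewrite size_allpairs mulnn. Qed.

Lemma sum_square (T : Type) (s : seq T) (F : T -> T -> nat) :
  (\sum_(p <- square T s) F p.1 p.2 = \sum_(x <- s) \sum_(y <- s) F x y)%N.
Proof. exact: big_allpairs. Qed.

Lemma intercepts_count (R : realFieldType) (A : seq R) (r q : R) :
  uniq A ->
  count (fun p => p.2 - r * p.1 == q) (square R A) = richness R A r q.
Proof.
move=> uA; rewrite -sum_bool_count big_allpairs /richness -sum_bool_count.
apply: eq_bigr => x _ /=.
rewrite -(count_uniq_mem _ uA) sum_bool_count; apply: eq_count => y /=.
by rewrite subr_eq addrC.
Qed.

Lemma mem_intercepts (F : fieldType) (A : seq F) (r : F) :
  {in square F A, forall p, p.2 - r * p.1 \in intercepts F A r}.
Proof. by move=> p pA; rewrite mem_undup (map_f (fun p => p.2 - r * p.1)). Qed.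

Lemma mem_ratios (F : fieldType) (B : seq F) :
  {in square F B, forall p, p.2 / p.1 \in ratios F B}.
Proof. by move=> p pB; rewrite mem_undup (map_f (fun p => p.2 / p.1)). Qed.

Lemma sum_ratio_count (F : fieldType) (B : seq F) :
  (\sum_(r <- ratios F B) ratio_count F B r = size B ^ 2)%N.
Proof.
rewrite -size_square -sum1_size.
rewrite (sum_fibers _ _ _ _ _ (fun=> 1%N) (undup_uniq _) (mem_ratios F B)).
by apply: eq_bigr => r _; rewrite muln1.
Qed.

Lemma sum_richness (R : realFieldType) (A : seq R) (r : R) :
  uniq A -> (\sum_(q <- intercepts R A r) richness R A r q = size A ^ 2)%N.
Proof.
move=> uA; rewrite -size_square -sum1_size.
rewrite (sum_fibers _ _ _ _ _ (fun=> 1%N) (undup_uniq _) (mem_intercepts R A r)).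
by apply: eq_bigr => q _; rewrite muln1 intercepts_count.
Qed.

(** The equation [b + c = r * (b' + c')] reads [b - r * b' = - (c - r * c')]: the points [(b', b)]
    and [(c', c)] lie on lines of slope [r] with opposite intercepts. *)
Lemma sum_dilate_energy_le (R : realFieldType) (A : seq R) (r : R) :
  uniq A ->
  (\sum_(p <- square R A) \sum_(p' <- square R A)
     (p.1 + p.2 == r * (p'.1 + p'.2))%R
   <= \sum_(q <- intercepts R A r) richness R A r q ^ 2)%N.
Proof.
move=> uA; pose g (p : R * R) := p.2 - r * p.1.
have -> : (\sum_(q <- intercepts R A r) richness R A r q ^ 2 =
    \sum_(p <- square R A) \sum_(p' <- square R A) (g p == g p'))%N.
  rewrite (sum_coincidences _ _ _ _ _ _ _ _ (undup_uniq _) (mem_intercepts R A r)).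
  by apply: eq_bigr => q _; rewrite -mulnn !intercepts_count.
apply: leq_trans (coincidences_opp_le _ _ (square R A) g).
rewrite eq_leq //.
have flat (F : R -> R -> R -> R -> nat) :
  (\sum_(p <- square R A) \sum_(p' <- square R A) F p.1 p.2 p'.1 p'.2 =
   \sum_(x <- A) \sum_(y <- A) \sum_(u <- A) \sum_(v <- A) F x y u v)%N.
  rewrite -(sum_square _ _ (fun x y => \sum_(u <- A) \sum_(v <- A) F x y u v)%N).
  by apply: eq_bigr => p _; rewrite sum_square.
rewrite (flat (fun x y u v => nat_of_bool (x + y == r * (u + v)))).
rewrite (flat (fun x y u v => nat_of_bool (y - r * x == - (v - r * u)))).
rewrite [RHS]exchange_big /=; apply: eq_bigr => b _.
under eq_bigr => c _ do rewrite exchange_big /=.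
have swap (G : R -> R -> R -> nat) :
  (\sum_(c <- A) \sum_(c' <- A) \sum_(b' <- A) G c c' b' =
   \sum_(b' <- A) \sum_(c' <- A) \sum_(c <- A) G c c' b')%N.
  rewrite exchange_big /=; under eq_bigr => c' _ do rewrite exchange_big /=.
  by rewrite exchange_big.
rewrite swap; apply: eq_bigr => b' _; apply: eq_bigr => c' _.
apply: eq_bigr => c _; congr (nat_of_bool _).
by apply/eqP/eqP => e; lra.
Qed.

(** Cauchy-Schwarz for the map [(b, p) -> b * (p.1 + p.2)] into [X]; its coincidences are grouped by
    the ratio [r = b' / b]. *)
Lemma sumprod_cauchy (R : realFieldType) (A B X : seq R) :
  uniq A -> uniq X -> 0 \notin B ->
  {in B & square R A, forall b p, b * (p.1 + p.2) \in X} ->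
  ((size B * size A ^ 2) ^ 2 <= size X *
     \sum_(r <- ratios R B) ratio_count R B r *
       \sum_(q <- intercepts R A r) richness R A r q ^ 2)%N.
Proof.
move=> uA uX B0 BX.
pose s := [seq (b, p) | b <- B, p <- square R A].
have sX : {in s, forall u, u.1 * (u.2.1 + u.2.2) \in X}.
  by move=> u /allpairsP[[b p] [bB pA ->]]; apply: BX.
have -> : (size B * size A ^ 2 = size s)%N by rewrite size_allpairs size_square.
apply: leq_trans (sqr_size_le_coincidences _ _ _ _ _ uX sX) _.
rewrite leq_mul2l; apply/orP; right.
pose E r := (\sum_(p <- square R A) \sum_(p' <- square R A)
     (p.1 + p.2 == r * (p'.1 + p'.2))%R)%N.
apply: (@leq_trans (\sum_(r <- ratios R B) ratio_count R B r * E r)%N); last first.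
  by apply: leq_sum => r _; rewrite leq_mul2l sum_dilate_energy_le ?orbT.
rewrite -(sum_fibers _ _ _ _ _ E (undup_uniq _) (mem_ratios R B)).
rewrite (sum_square _ _ (fun x y => E (y / x))) eq_leq //.
rewrite big_allpairs /= big_seq [RHS]big_seq; apply: eq_bigr => b bB.
under eq_bigr => p _ do rewrite big_allpairs /=.
rewrite exchange_big /=; apply: eq_bigr => b' _.
apply: eq_bigr => p _; apply: eq_bigr => p' _; congr (nat_of_bool _).
have b0 : b != 0 by apply: contraNneq B0 => <-.
by apply/eqP/eqP => [e|->]; [apply: (mulfI b0); rewrite e|]; field.
Qed.

(** * Harmonic sums and the cubic moment of the ratio counts *)

Lemma harmonic_sum_le (R : realType) (n : nat) (t : R) :
  (0 < n)%N -> 0 < t -> t ^+ 12 = n%:R ->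
  \sum_(1 <= s < n.+1) s%:R^-1 <= 12 * t.
Proof.
move=> n0 t0 tn.
have Hln : \sum_(1 <= s < n.+1) s%:R^-1 <= 1 + ln (n%:R : R).
  case: n n0 {tn} => // n _; elim: n => [|n IH].
    by rewrite big_nat1 ln1 invr1 addr0.
  rewrite big_nat_recr //=.
  have n1 : 0 < n.+1%:R :> R by rewrite ltr0n.
  have n2 : 0 < n.+2%:R :> R by rewrite ltr0n.
  have n21 : n.+2%:R = n.+1%:R + 1 :> R by rewrite -natr1.
  have quot : n.+1%:R / n.+2%:R = 1 + - n.+2%:R^-1 :> R.
    by rewrite n21 in n2 *; field; rewrite gt_eqF.
  have quot0 : 0 < n.+1%:R / n.+2%:R :> R by rewrite divr_gt0.
  have inv_lt : -1 < - n.+2%:R^-1 :> R.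
    by rewrite -subr_gt0 opprK addrC -quot.
  have := le_ln1Dx inv_lt; rewrite -quot ln_div ?posrE // => ln_le.
  by rewrite -(subrK (ln n.+1%:R) (ln n.+2%:R)); set x := ln n.+2%:R in ln_le *;
    set y := ln n.+1%:R in ln_le IH *; set z := n.+2%:R^-1 in ln_le *; lra.
(* The logarithm is absorbed into a small power: [ln n = 12 * ln t <= 12 * (t - 1)]. *)
apply: le_trans Hln _; rewrite -tn lnXn // -mulr_natl.
by have := @le_ln1Dx R (t - 1) ltac:(lra); rewrite addrC subrK; lra.
Qed.

(** The set [B]; removing [0] keeps the ratios clear of the convention [x / 0 = 0]. *)
Definition shift_nz (R : nzRingType) (A : seq R) (a : R) : seq R :=
  [seq d + a | d <- A & d + a != 0].

Lemma shift_nz_uniq (R : nzRingType) (A : seq R) (a : R) :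
  uniq A -> uniq (shift_nz R A a).
Proof. by move=> uA; rewrite map_inj_uniq ?filter_uniq //; apply: addIr. Qed.

Lemma shift_nz_neq0 (R : nzRingType) (A : seq R) (a : R) : 0 \notin shift_nz R A a.
Proof.
by apply/mapP => -[d]; rewrite mem_filter => /andP[d0 _] e; rewrite -e eqxx in d0.
Qed.

Lemma size_shift_nz (R : nzRingType) (A : seq R) (a : R) :
  (size (shift_nz R A a) <= size A)%N.
Proof. by rewrite size_map size_filter count_size. Qed.

Lemma size_shift_nz_ge (R : nzRingType) (A : seq R) (a : R) :
  uniq A -> (size A <= (size (shift_nz R A a)).+1)%N.
Proof.
move=> uA; rewrite size_map size_filter -(count_predC (fun d => d + a != 0) A).
rewrite -addn1 leq_add2l; apply: count_le1 => // x y /= /negPn/eqP x0 /negPn/eqP y0.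
by apply: (@addIr _ a); rewrite x0 y0.
Qed.

(** If [d' + a = r * (d + a)], then [(d, d')] lies on the line of slope [r] through [(- a, - a)],
    whose intercept is [(r - 1) * a]. *)
Lemma ratio_count_shift_le (R : realFieldType) (A : seq R) (a r : R) :
  uniq A ->
  (ratio_count R (shift_nz R A a) r <= richness R A r ((r - 1) * a))%N.
Proof.
move=> uA; set B := shift_nz R A a.
have uB : uniq B by exact: shift_nz_uniq.
apply: (@leq_trans (\sum_(x <- B) (r * x \in B)%R)).
  rewrite /ratio_count -sum_bool_count big_allpairs /= big_seq [leqRHS]big_seq.
  apply: leq_sum => x xB; rewrite -(count_uniq_mem _ uB) sum_bool_count.
  apply: sub_count => y /= /eqP <-; rewrite divfK //.
  by apply: contraTneq xB => ->; apply: shift_nz_neq0.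
rewrite big_map big_filter big_mkcond /= /richness -sum_bool_count.
apply: leq_sum => d _; case: ifP => // _.
have [/mapP[d' + e]|//] := boolP (r * (d + a) \in B).
rewrite mem_filter => /andP[_ d'A].
by rewrite (_ : r * d + _ = d') ?d'A //; apply: (@addIr _ a); rewrite -e; ring.
Qed.

Lemma size_ratios (F : fieldType) (B : seq F) : (size (ratios F B) <= size B ^ 2)%N.
Proof. by rewrite (leq_trans (size_undup _)) // size_map size_square. Qed.

Lemma ratios_neq0 (F : fieldType) (B : seq F) :
  0 \notin B -> {in ratios F B, forall r, r != 0}.
Proof.
move=> B0 r; rewrite mem_undup => /mapP[p /allpairsP[[x y] [/= xB yB ->]] ->] /=.
by rewrite mulf_eq0 invr_eq0 negb_or !(memPn B0).
Qed.

Lemma size_intercepts (F : fieldType) (A : seq F) (r : F) :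
  (size (intercepts F A r) <= size A ^ 2)%N.
Proof. by rewrite (leq_trans (size_undup _)) // size_map size_square. Qed.

(* For [r != 1] the lines of slope [r] through the points [(- a, - a)] of the
   diagonal are distinct for distinct [a], so the cubic moment bound applies. *)
Lemma sum_ratio_count_cube_le (R : realFieldType) (A : seq R) :
  uniq A ->
  ((\sum_(a <- A) \sum_(r <- ratios R (shift_nz R A a))
      ratio_count R (shift_nz R A a) r ^ 3)%:R
   <= (size A)%:R ^+ 4 + (128 * (size A)%:R ^+ 4 *
       (\sum_(1 <= s < (size A).+1) s%:R^-1) + 27 * (size A)%:R ^+ 3) :> R).
Proof.
move=> uA; set n := size A.
pose Ra a := [seq r <- ratios R (shift_nz R A a) | r != 1].
pose L := [seq (r, (r - 1) * a) | a <- A, r <- Ra a].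
have uL : uniq L.
  apply: allpairs_uniq_dep => //.
    by move=> a _; rewrite filter_uniq ?undup_uniq.
  move=> _ _ /allpairsPdep[a [r [aA rR ->]]] /allpairsPdep[a' [r' [_ rR' ->]]] /=.
  move=> [er]; subst r' => /mulfI ea; rewrite ea // subr_eq0.
  by move: rR; rewrite mem_filter => /andP[].
have L0 : {in L, forall l, l.1 != 0}.
  move=> _ /allpairsPdep[a [r [_ + ->]]] /=; rewrite mem_filter => /andP[_].
  by apply: ratios_neq0; apply: shift_nz_neq0.
have sL : (size L <= n ^ 3)%N.
  rewrite -sum1_size big_allpairs_dep /= expnS -[X in (X * _)%N]/(size A).
  rewrite -[X in (X * _)%N]sum1_size big_distrl /=.
  apply: leq_sum => a _; rewrite mul1n sum1_size size_filter.
  rewrite (leq_trans (count_size _ _)) // (leq_trans (size_ratios _ _)) //.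
  by rewrite leq_exp2r // size_shift_nz.
have main : (\sum_(a <- A) \sum_(r <- ratios R (shift_nz R A a))
      ratio_count R (shift_nz R A a) r ^ 3
    <= n ^ 4 + \sum_(l <- L) richness R A l.1 l.2 ^ 3)%N.
  rewrite big_allpairs_dep /= expnS -[X in (X * _ + _)%N]/(size A).
  rewrite -[X in (X * _ + _)%N]sum1_size big_distrl /= -big_split /=; apply: leq_sum => a _; rewrite mul1n big_filter.
  (* At [r = 1] every [a] gives the same line; the trivial bound [n ^ 3] for each [a] accounts for
     the [n ^ 4]. *)
  rewrite (bigID (fun r => r != 1)) /= addnC; apply: leq_add; last first.
    by apply: leq_sum => r _; rewrite leq_exp2r // ratio_count_shift_le.
  under eq_bigl => r do rewrite negbK.
  rewrite -big_filter; set s := seq.filter _ _.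
  have ss : (size s <= 1)%N.
    rewrite size_filter; apply: count_le1 (undup_uniq _) _ => x y.
    by move=> /eqP-> /eqP->.
  apply: (@leq_trans (\sum_(r <- s) n ^ 3)%N).
    apply: leq_sum => r _; rewrite leq_exp2r //.
    by rewrite (leq_trans (ratio_count_shift_le _ _ _ _ uA)) ?count_size.
  rewrite big_const_seq count_predT iter_addn_0.
  by rewrite -[leqRHS]muln1 leq_mul2l ss orbT.
apply: le_trans (_ : _ <= (n ^ 4 + \sum_(l <- L) richness R A l.1 l.2 ^ 3)%N%:R) _.
  by rewrite ler_nat.
rewrite natrD natrX lerD2l; apply: le_trans (sum_richness_cube_le _ _ _ uA uL L0) _.
by rewrite lerD2l ler_wpM2l // -natrX ler_nat.
Qed.

(** * Combining the two cubic moments *)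

(* The weights of the arithmetic-geometric means balance the three terms when
   [t ^+ 12] is the size of [A]. *)
Lemma third_moment_amgm (R : realFieldType) (t j k : R) :
  0 <= j -> 0 <= k ->
  4 * t ^+ 9 * (k * j ^+ 2) <= 2 * t ^+ 12 * j ^+ 3 + j * k ^+ 3 + t ^+ 12 * (j * k).
Proof.
move=> j0 k0; rewrite -subr_ge0.
have -> : 2 * t ^+ 12 * j ^+ 3 + j * k ^+ 3 + t ^+ 12 * (j * k) -
   4 * t ^+ 9 * (k * j ^+ 2) =
   2 * j * (t ^+ 6 * j - t ^+ 3 * k) ^+ 2 + j * k * (k - t ^+ 6) ^+ 2 by ring.
by rewrite addr_ge0 // mulr_ge0 ?sqr_ge0 ?mulr_ge0.
Qed.

(** The pointwise inequality is summed over all lines [(r, q)]. The richnesses of one slope add up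
    to [n ^ 2], which reduces the two mixed terms to moments of [ratio_count]. *)
Lemma sum_energy_le (R : realFieldType) (A B : seq R) (t : R) :
  uniq A -> 0 \notin B -> (size B <= size A)%N ->
  4 * t ^+ 9 * (\sum_(r <- ratios R B) ratio_count R B r *
       \sum_(q <- intercepts R A r) richness R A r q ^ 2)%N%:R
  <= 2 * t ^+ 12 * (128 * (size A)%:R ^+ 4 * (\sum_(1 <= s < (size A).+1) s%:R^-1) + 27 * (size A)%:R ^+ 4)
     + (size A)%:R ^+ 2 * (\sum_(r <- ratios R B) ratio_count R B r ^ 3)%N%:R
     + t ^+ 12 * (size A)%:R ^+ 4.
Proof.
move=> uA B0 BA; set n : R := (size A)%:R.
pose L := [seq (r, q) | r <- ratios R B, q <- intercepts R A r].
have uL : uniq L.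
  apply: allpairs_uniq_dep; first exact: undup_uniq.
    by move=> r _; apply: undup_uniq.
  by move=> [r q] [r' q'] _ _ /= [-> ->].
have L0 : {in L, forall l, l.1 != 0}.
  by move=> _ /allpairsPdep[r [q [+ _ ->]]]; apply: ratios_neq0.
have sB : (size B ^ 2 <= size A ^ 2)%N by rewrite leq_exp2r.
have sL : (size L <= size A ^ 4)%N.
  rewrite -sum1_size big_allpairs_dep /= (expnD _ 2 2).
  apply: (@leq_trans (\sum_(r <- ratios R B) size A ^ 2)%N).
    by apply: leq_sum => r _; rewrite sum1_size size_intercepts.
  rewrite big_const_seq count_predT iter_addn_0 leq_mul2l.
  by rewrite (leq_trans (size_ratios _ _)) ?orbT.
have cube : (\sum_(r <- ratios R B) \sum_(q <- intercepts R A r)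
      richness R A r q ^ 3)%N%:R
    <= 128 * n ^+ 4 * (\sum_(1 <= s < (size A).+1) s%:R^-1) + 27 * n ^+ 4 :> R.
  have := sum_richness_cube_le _ _ _ uA uL L0; rewrite big_allpairs_dep /=.
  move=> /le_trans; apply; rewrite lerD2l ler_wpM2l // /n -natrX ler_nat //.
have pointwise : 4 * t ^+ 9 * (\sum_(r <- ratios R B) ratio_count R B r *
       \sum_(q <- intercepts R A r) richness R A r q ^ 2)%N%:R <=
   2 * t ^+ 12 * (\sum_(r <- ratios R B) \sum_(q <- intercepts R A r)
      richness R A r q ^ 3)%N%:R
   + (\sum_(r <- ratios R B) \sum_(q <- intercepts R A r)
       richness R A r q * ratio_count R B r ^ 3)%N%:R
   + t ^+ 12 * (\sum_(r <- ratios R B) \sum_(q <- intercepts R A r)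
       richness R A r q * ratio_count R B r)%N%:R.
  rewrite !natr_sum !mulr_sumr -!big_split /=; apply: ler_sum => r _.
  rewrite natrM !natr_sum !mulr_sumr -!big_split /=; apply: ler_sum => q _.
  set j := richness R A r q; set k := ratio_count R B r.
  have := third_moment_amgm _ t j%:R k%:R (ler0n _ _) (ler0n _ _).
  by rewrite -!natrX -!natrM.
have marginal (F : R -> nat) : (\sum_(r <- ratios R B) \sum_(q <- intercepts R A r)
       richness R A r q * F r = size A ^ 2 * \sum_(r <- ratios R B) F r)%N.
  rewrite big_distrr /=; apply: eq_bigr => r _.
  by rewrite -big_distrl /= sum_richness.
apply: (le_trans pointwise); rewrite (marginal (fun r => ratio_count R B r ^ 3)%N).
rewrite (marginal (ratio_count R B)) sum_ratio_count.
have t12 : 0 <= t ^+ 12 by rewrite (exprM _ 6 2) sqr_ge0.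
apply: lerD; first apply: lerD.
- by rewrite ler_wpM2l // mulr_ge0.
- by rewrite natrM natrX.
- by rewrite ler_wpM2l // -natrX ler_nat (expnD _ 2 2) leq_mul2l sB orbT.
Qed.

(** * Choice of the subset and the final bound *)

(** Markov's inequality: at most half of the indices can exceed twice the mean. *)
Lemma half_count_le (R : realFieldType) (I : Type) (s : seq I) (F : I -> nat) (M : R) :
  0 < M -> (\sum_(a <- s) F a)%N%:R <= (size s)%:R * M / 2 ->
  (size s)%:R / 2 <= (count (fun a => (F a)%:R <= M) s)%:R :> R.
Proof.
move=> M0 sumF; have := count_predC (fun a => (F a)%:R <= M) s.
set k := count _ s; set k' := count _ s => kk.
have : M * k'%:R <= (\sum_(a <- s) F a)%N%:R.
  rewrite /k' -sum_bool_count !natr_sum mulr_sumr; apply: ler_sum => a _ /=.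
  by case: (leP (F a)%:R M) => [_|/ltW Fa] /=; rewrite ?mulr0 ?mulr1.
move=> /le_trans/(_ sumF); rewrite mulrAC [leRHS]mulrC ler_pM2l //.
by rewrite -kk natrD => ?; lra.
Qed.

(** With [n = t ^ 12], the hypothesis is the cubic moment bound [n ^ 3 * t]. It makes the energy [S]
    of order [t ^ 52], against [n ^ 6 = t ^ 72] in Cauchy-Schwarz. *)
Lemma card_AA_Aa_ge (R : realType) (A : {fset R}) (a t : R) :
  (1 < #|` A|)%N -> 1 <= t -> t ^+ 12 = #|` A|%:R ->
  (\sum_(r <- ratios R (shift_nz R A a)) ratio_count R (shift_nz R A a) r ^ 3)%N%:R
    <= 3128 * t ^+ 37 ->
  t ^+ 20 <= 6255 * #|` AA_Aa A a|%:R.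
Proof.
move=> A1 t1 tn FM; set B := shift_nz R A a in FM.
have uA : uniq A := fset_uniq A.
have t0 : 0 < t by lra.
have AX : {in B & square R A, forall b p, b * (p.1 + p.2) \in AA_Aa A a}.
  move=> b p /mapP[d + ->] /allpairsP[[x y] [/= xA yA ->]] /=.
  rewrite mem_filter => /andP[_ dA]; rewrite mulrC /AA_Aa /prodset.
  by apply: in_imfset2; [apply: in_imfset2 | apply: in_imfset].
have cauchy := sumprod_cauchy R A B (AA_Aa A a) uA (fset_uniq _)
  (shift_nz_neq0 _ _ _) AX.
have energy := sum_energy_le R A B t uA (shift_nz_neq0 _ _ _) (size_shift_nz _ _ _).
(* At most one element is lost and [n >= 2]; squaring this costs the factor [4] in [cauchy']. *)
have Bn : (size A <= 2 * size B)%N.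
  have := size_shift_nz_ge _ A a uA; rewrite -/B; move: A1.
  by set k := size A; set l := size B; lia.
move: cauchy energy; set S := (\sum_(r <- _) _)%N => cauchy energy.
have harm := harmonic_sum_le R (size A) t (ltnW A1) t0 tn.
have t61 : t ^+ 60 <= t ^+ 61 by rewrite ler_weXn2l.
(* The constant is [2 * 128 * 12 + 3128 = 6200] from [t ^ 61], plus [2 * 27 + 1 = 55] from
   [t ^ 60]. *)
have energy' : 4 * t ^+ 9 * S%:R <= 6255 * t ^+ 61.
  apply: (le_trans energy); rewrite -tn.
  apply: le_trans (_ : _ <= 2 * t ^+ 12 * (128 * (t ^+ 12) ^+ 4 * (12 * t)
     + 27 * (t ^+ 12) ^+ 4) + (t ^+ 12) ^+ 2 * (3128 * t ^+ 37)
     + t ^+ 12 * (t ^+ 12) ^+ 4) _.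
    rewrite lerD2r; apply: lerD; last by rewrite ler_wpM2l ?exprn_ge0 // ltW.
    rewrite ler_wpM2l ?mulr_ge0 ?exprn_ge0 ?(ltW t0) // lerD2r.
    by rewrite ler_wpM2l ?mulr_ge0 ?exprn_ge0 ?(ltW t0).
  have -> : 2 * t ^+ 12 * (128 * (t ^+ 12) ^+ 4 * (12 * t)
     + 27 * (t ^+ 12) ^+ 4) + (t ^+ 12) ^+ 2 * (3128 * t ^+ 37)
     + t ^+ 12 * (t ^+ 12) ^+ 4 = 6200 * t ^+ 61 + 55 * t ^+ 60 by ring.
  lra.
have cauchy' : t ^+ 72 <= 4 * (#|` AA_Aa A a|%:R * S%:R).
  have -> : t ^+ 72 = ((size A)%:R * (size A)%:R ^+ 2) ^+ 2 by rewrite -tn; ring.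
  rewrite -!natrX -!natrM -natrX ler_nat.
  apply: leq_trans (_ : _ <= 4 * (size B * size A ^ 2) ^ 2)%N _; last by rewrite leq_mul2l.
  by rewrite -(expnMn 2 _ 2) mulnA leq_exp2r // leq_mul2r Bn orbT.
have t61p : 0 < t ^+ 61 by rewrite exprn_gt0.
rewrite -(ler_pM2l t61p) -exprD -[(61 + 20)%N]/(9 + 72)%N exprD.
apply: le_trans (_ : _ <= t ^+ 9 * (4 * (#|` AA_Aa A a|%:R * S%:R))) _.
  by rewrite ler_wpM2l ?exprn_ge0 // ltW.
rewrite [leLHS](_ : _ = #|` AA_Aa A a|%:R * (4 * t ^+ 9 * S%:R)); last by ring.
rewrite [leRHS](_ : _ = #|` AA_Aa A a|%:R * (6255 * t ^+ 61)); last by ring.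
by rewrite ler_wpM2l.
Qed.

Theorem theorem2p10 (R : realType) :
  exists c : R, 0 < c /\
  forall A : {fset R},
    exists A' : {fset R},
      (A' `<=` A)%fset /\
      (#|` A|%:R / 2 <= #|` A'|%:R :> R) /\
      forall a : R, a \in A' ->
        c * ((#|` A|%:R : R) `^ (5 / 3)) / ((log2 (#|` A|%:R : R)) `^ (1 / 3))
          <= (#|` AA_Aa A a|%:R : R).
Proof.
exists 6255^-1; split=> [|A]; first by rewrite invr_gt0 ltr0n.
have [A1|A1] := leqP #|` A| 1.
  exists A; split; first exact: fsubset_refl.
  split=> [|a _]; first by have : 0 <= #|` A|%:R :> R by []; lra.
  (* Here [ln] vanishes ([ln 0 = 0] by convention), hence so does the denominator, and division by
     zero makes the left side [0]. *)
  have ln0A : ln (#|` A|%:R : R) = 0.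
    by case: #|` A| A1 => [|[]] // _; rewrite ?ln1 // ln0.
  have third0 : 1 / 3 != 0 :> R by rewrite mulf_neq0 ?oner_eq0 ?invr_eq0 ?pnatr_eq0.
  by rewrite /log2 ln0A mul0r powR0 // invr0 mulr0.
have n1 : 1 <= #|` A|%:R :> R by rewrite ler1n ltnW.
pose t : R := #|` A|%:R `^ 12^-1.
have powt k : t ^+ k = #|` A|%:R `^ (k%:R / 12).
  by rewrite -powR_mulrn ?powR_ge0 // -powRrM mulrC.
have tn : t ^+ 12 = #|` A|%:R by rewrite powt divff // powRr1.
have t1 : 1 <= t.
  by rewrite -[leLHS](powRr0 (#|` A|%:R : R)) ler_powR // invr_ge0.
have t0 : 0 < t by lra.
pose F (a : R) := (\sum_(r <- ratios R (shift_nz R A a))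
  ratio_count R (shift_nz R A a) r ^ 3)%N.
(* The total is at most [(1 + 128 * 12 + 27) * t ^ 49 = 1564 * t ^ 49]; doubling the mean gives the
   threshold [3128 * t ^ 37]. *)
have sumF : (\sum_(a <- A) F a)%N%:R <= #|` A|%:R * (3128 * t ^+ 37) / 2.
  apply: le_trans (sum_ratio_count_cube_le R A (fset_uniq A)) _.
  have harm := harmonic_sum_le R #|` A| t (ltnW A1) t0 tn.
  rewrite -tn in harm *.
  apply: le_trans (_ : _ <= (t ^+ 12) ^+ 4 + (128 * (t ^+ 12) ^+ 4 * (12 * t)
    + 27 * (t ^+ 12) ^+ 3)) _.
    by rewrite lerD2l lerD2r ler_wpM2l // mulr_ge0 // !exprn_ge0 // ltW.
  have t48 : t ^+ 48 <= t ^+ 49 by rewrite ler_weXn2l.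
  have t36 : t ^+ 36 <= t ^+ 49 by rewrite ler_weXn2l.
  rewrite [leLHS](_ : _ = t ^+ 48 + 1536 * t ^+ 49 + 27 * t ^+ 36); last by ring.
  rewrite [leRHS](_ : _ = 1564 * t ^+ 49); last by field.
  by lra.
pose P a : bool := (F a)%:R <= 3128 * t ^+ 37.
exists [fset x in [seq a <- A | P a]]%fset; split.
  by apply/fsubsetP => a; rewrite inE mem_filter => /andP[].
split=> [|a].
  rewrite card_fseq undup_id ?filter_uniq ?fset_uniq // size_filter.
  by apply: half_count_le sumF; rewrite mulr_gt0 ?ltr0n ?exprn_gt0.
rewrite inE mem_filter => /andP[FM _].
have main := card_AA_Aa_ge R A a t A1 t1 tn FM.
have -> : #|` A|%:R `^ (5 / 3) = t ^+ 20.
  by rewrite powt; congr (_ `^ _); field.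
(* As [n >= 2], the denominator is at least [1], so [t ^ 20 / 6255] already dominates the left
   side. *)
have log1 : 1 <= log2 (#|` A|%:R : R).
  rewrite /log2 ler_pdivlMr ?mul1r; last by rewrite ln_gt0 ?ltr1n.
  by rewrite ler_ln ?posrE ?ltr0n ?ler_nat // ltnW.
have log13 : 1 <= log2 (#|` A|%:R : R) `^ (1 / 3).
  by rewrite -[leLHS](powRr0 (log2 (#|` A|%:R : R))) ler_powR // divr_ge0.
rewrite ler_pdivrMr; last lra.
apply: le_trans (_ : _ <= #|` AA_Aa A a|%:R) _; first by rewrite ler_pdivrMl ?ltr0n.
by rewrite ler_peMr.
Qed.
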